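(* Let $\mathcal N$ be a finite, locally irreducible, strongly connected and critical abelian network, and let $u$ be an update rule on $\mathcal N$ satisfying: (H1) for every configuration $\mathbf x.\mathbf q$ such that $\mathbf x\in\mathbb N^A\setminus\{\mathbf 0\}$, the update word $u(\mathbf x.\mathbf q)$ is a nonempty word; and (H2) for every $a\in A$ and all configurations $\mathbf x.\mathbf q$, $\mathbf x'.\mathbf q'$ with $\mathbf x.\mathbf q\xrightarrow{a}\mathbf x'.\mathbf q'$, one has $|u(\mathbf x.\mathbf q)|\le|a|+|u(\mathbf x'.\mathbf q')|$. If $\mathbf x.\mathbf q$ and $\mathbf x'.\mathbf q'$ are legally related configurations, then $\mathrm{act}_u(\mathbf x.\mathbf q)=\mathrm{act}_u(\mathbf x'.\mathbf q')$.
   Context: Abelian networks. $\mathbb N=\{0,1,2,\dots\}$. Let $G=(V,E)$ be a finite directed graph (self-loops and multiple edges allowed). An abelian network $\mathcal N$ on $G$ assigns to each $v\in V$ a nonempty input alphabet $A_v$ and a nonempty state space $Q_v$ (the $A_v$ pairwise disjoint), maps $T_a:Q_v\to Q_v$ for $a\in A_v$, and, for each edge $e$ from $v$ to $u$, a message-passing function $T_e:Q_v\times A_v\to A_u^*$ (free monoid of words), such that for all $v$, $a,b\in A_v$, $q\in Q_v$: $T_aT_b=T_bT_a$, and for every edge $e$ out of $v$ the words $T_e(q,a)T_e(T_a(q),b)$ and $T_e(q,b)T_e(T_b(q),a)$ agree up to permuting letters. Put $A=\bigsqcup_v A_v$, $Q=\prod_v Q_v$; $\mathcal N$ is finite if $A$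 and $Q$ are finite. For a word $w\in A^*$, $|w|\in\mathbb N^A$ counts the occurrences of each letter. For $a\in A_v$, $\mathbf q\in Q$: $t_a\mathbf q$ is $\mathbf q$ with $\mathbf q(v)$ replaced by $T_a(\mathbf q(v))$, and $\mathbf M_a(\mathbf q)=\sum_{e\text{ out of }v}|T_e(\mathbf q(v),a)|\in\mathbb N^A$. A configuration is a pair $\mathbf x.\mathbf q$ with $\mathbf x\in\mathbb Z^A$, $\mathbf q\in Q$; $\pi_a(\mathbf x.\mathbf q)=(\mathbf x+\mathbf M_a(\mathbf q)-|a|).t_a\mathbf q$. For $w=a_1\cdots a_\ell$: $t_w=t_{a_\ell}\cdots t_{a_1}$, $\mathbf M_w(\mathbf q)=\sum_i\mathbf M_{a_i}(t_{a_1\cdots a_{i-1}}\mathbf q)$, $\pi_w=\pi_{a_\ell}\cdots\pi_{a_1}$; these depend only on $|w|$, so $t_{\mathbf n},\mathbf M_{\mathbf n},\pi_{\mathbf n}$ are defined for $\mathbf n\in\mathbb N^A$. The word $w$ is a legal execution for $\mathbf x.\mathbf q$ if, with $\mathbf x_i.\mathbf q_i=\pi_{a_1\cdots a_i}(\mathbf x.\mathbf q)$, $\mathbf x_{i-1}(a_i)\ge1$ for all $1\le i\le\ell$. Write $\mathbf x.\mathbf q\xrightarrow{w}\mathbf x'.\mathbf q'$ if $w$ is legal for $\mathbf x.\mathbf q$ and $\pi_w(\mathbf x.\mathbf q)=\mathbf x'.\mathbf q'$; write $\mathbf x.\mathbf q\to\mathbf x'.\mathbf q'$ if this holds for some (possibly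 empty) $w$. Vector inequalities are coordinatewise. Two configurations $\mathbf x_1.\mathbf q_1,\mathbf x_2.\mathbf q_2$ are legally related if there is a configuration $\mathbf x_3.\mathbf q_3$ with $\mathbf x_1.\mathbf q_1\to\mathbf x_3.\mathbf q_3$ and $\mathbf x_2.\mathbf q_2\to\mathbf x_3.\mathbf q_3$. Local recurrence, kernel, production matrix. $\mathcal N$ is locally irreducible if for all $\mathbf q,\mathbf q'\in Q$ there are words $w,w'$ with $t_w\mathbf q=t_{w'}\mathbf q'$. For $\mathcal N$ finite, let $e$ be the product of all idempotents of the finite commutative monoid generated by the $t_a$ in $\mathrm{End}(Q)$; $\mathrm{Loc}(\mathcal N)=eQ$. The total kernel is $K=\{\mathbf z\in\mathbb Z^A: t_{\mathbf z^+}\mathbf q=t_{\mathbf z^-}\mathbf q\ \forall\mathbf q\in\mathrm{Loc}(\mathcal N)\}$, with $\mathbf z^{\pm}\in\mathbb N^A$ the positive/negative parts of $\mathbf z$. For $\mathcal N$ finite and locally irreducible, the production matrix $P$ is the unique rational $A\times A$ matrix with $P\mathbf k=\mathbf M_{\mathbf k}(\mathbf q)$ for all $\mathbf k\in K\cap\mathbb N^A$ and $\mathbf q\in\mathrm{Loc}(\mathcal N)$. $\mathcal N$ is critical if the spectral radius of $P$ is $1$, and strongly connected if the digraph on $A$ with an edge $(a,b)$ whenever $P_{ba}>0$ is strongly connected. Update rules and activity. An update rule $u$ assigns to each configuration $\mathbf x.\mathbf q$ a word $u(\mathbf x.\mathbf q)\in A^*$ (the update word) that is a legal execution for $\mathbf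 x.\mathbf q$. The update function is $U(\mathbf x.\mathbf q)=\pi_{u(\mathbf x.\mathbf q)}(\mathbf x.\mathbf q)$. With $u_i=u(U^{i-1}(\mathbf x.\mathbf q))$ for $i\ge1$, the activity vector is $\mathrm{act}_u(\mathbf x.\mathbf q)=\lim_{n\to\infty}\frac1n\sum_{i=1}^n|u_i|$ (the limit exists because the sequence $U^i(\mathbf x.\mathbf q)$ is eventually periodic).
   Formalization: The two legally related configurations are assumed to satisfy x, x' ∈ N^A; for x with negative entries the claim fails, since (H1) does not prevent the update word from being empty there. *)

(* Defs.v *)
From HB Require Import structures.
From mathcomp Require Import all_boot all_order all_algebra all_field.
From mathcomp Require Import all_classical all_reals all_analysis.

Set Implicit Arguments.
Unset Strict Implicit.
Unset Printing Implicit Defensive.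

Import Order.TTheory GRing.Theory Num.Theory numFieldNormedType.Exports.

Local Open Scope classical_set_scope.
Local Open Scope ring_scope.

(* Finite directed multigraphs, self-loops allowed. *)
Record digraph := Digraph {
  vertex : finType;
  edge : finType;
  src : edge -> vertex;
  tgt : edge -> vertex }.

Record finite_abelian_network (G : digraph) := FiniteAbelianNetwork {
  alphabet : vertex G -> finType;
  state : vertex G -> finType;
  transition : forall v, alphabet v -> state v -> state v;
  message : forall e : edge G,
    state (src e) -> alphabet (src e) -> seq (alphabet (tgt e));
  alphabet_nonempty : forall v, (0 < #|alphabet v|)%N;
  state_nonempty : forall v, (0 < #|state v|)%N;
  transitionC : forall v (a b : alphabet v) (q : state v),
    transition a (transition b q) = transition b (transition a q);
  message_perm : forall (e : edge G) (a b : alphabet (src e))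
      (q : state (src e)),
    perm_eq (message q a ++ message (transition a q) b)
            (message q b ++ message (transition b q) a) }.

Section AbelianNetwork.
Variables (G : digraph) (N : finite_abelian_network G).

(* The disjoint union A of the alphabets, and the product Q of the states. *)
Definition letter : finType := {v : vertex G & alphabet N v}.
Definition gstate : finType := {dffun forall v : vertex G, state N v}.

Definition config : Type := ({ffun letter -> int} * gstate)%type.

(* |w| *)
Definition parikh (w : seq letter) : {ffun letter -> nat} :=
  [ffun a => count_mem a w].

(* The vector |a|, a single letter, in Z^A. *)
Definition unit_vec (a : letter) : {ffun letter -> int} :=
  [ffun b => (b == a)%:Z].

(* t_a q *)
Definition act_letter (a : letter) (q : gstate) : gstate :=
  finfun (eqtype.dfwith q (transition (tagged a) (q (tag a)))).

(* M_a(q); [untag] only serves to view [a] as a letter of the alphabet of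
   [src e], which is legitimate because [src e = tag a]. *)
Definition msg_letter (a : letter) (q : gstate) : {ffun letter -> nat} :=
  [ffun b => \sum_(e : edge G | src e == tag a)
     untag 0%N (fun a' : alphabet N (src e) =>
       count_mem b [seq (Tagged (alphabet N) c : letter)
                   | c <- message (q (src e)) a']) a]%N.

(* Words act from their first letter to their last one. *)
Fixpoint act_word (w : seq letter) (q : gstate) : gstate :=
  if w is a :: w' then act_word w' (act_letter a q) else q.

Fixpoint msg_word (w : seq letter) (q : gstate) : {ffun letter -> nat} :=
  if w is a :: w' then
    [ffun b => (msg_letter a q b + msg_word w' (act_letter a q) b)%N]
  else [ffun=> 0%N].

Definition fire (a : letter) (c : config) : config :=
  ([ffun b => c.1 b + (msg_letter a c.2 b)%:Z - unit_vec a b],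
   act_letter a c.2).

Fixpoint fire_word (w : seq letter) (c : config) : config :=
  if w is a :: w' then fire_word w' (fire a c) else c.

(* t_n and M_n for n in N^A: both maps depend on a word only through its
   letter counts, so one word with letter counts n is enough. *)
Definition word_of (n : {ffun letter -> nat}) : seq letter :=
  flatten [seq nseq (n a) a | a <- enum letter].

Definition act_vec (n : {ffun letter -> nat}) : gstate -> gstate :=
  act_word (word_of n).

Definition msg_vec (n : {ffun letter -> nat}) :
    gstate -> {ffun letter -> nat} :=
  msg_word (word_of n).

Fixpoint legal (w : seq letter) (c : config) : bool :=
  if w is a :: w' then (1 <= c.1 a) && legal w' (fire a c) else true.

Definition executes (w : seq letter) (c c' : config) : Prop :=
  legal w c /\ fire_word w c = c'.

Definition leads_to (c c' : config) : Prop := exists w, executes w c c'.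

Definition legally_related (c1 c2 : config) : Prop :=
  exists c3, leads_to c1 c3 /\ leads_to c2 c3.

Definition locally_irreducible : Prop :=
  forall q q' : gstate, exists w w', act_word w q = act_word w' q'.

(* The transition monoid inside End(Q), and the product e of its idempotents.
   They commute, so the order in which [\big] composes them is immaterial. *)
Definition transition_monoid (f : {ffun gstate -> gstate}) : Prop :=
  exists w, f = [ffun q => act_word w q].

Definition ffun_comp (f g : {ffun gstate -> gstate}) :
  {ffun gstate -> gstate} := [ffun q => f (g q)].

Definition min_idempotent : {ffun gstate -> gstate} :=
  \big[ffun_comp/[ffun q => q]]_(f : {ffun gstate -> gstate}
      | `[< transition_monoid f >] && (ffun_comp f f == f)) f.

Definition locally_recurrent : {set gstate} :=
  [set min_idempotent q | q : gstate]%SET.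

Definition pos_part (z : {ffun letter -> int}) : {ffun letter -> nat} :=
  [ffun a => `|Num.max (z a) 0|%N].

Definition neg_part (z : {ffun letter -> int}) : {ffun letter -> nat} :=
  [ffun a => `|Num.max (- z a) 0|%N].

Definition total_kernel (z : {ffun letter -> int}) : Prop :=
  forall q, q \in locally_recurrent ->
    act_vec (pos_part z) q = act_vec (neg_part z) q.

(* Column vectors and A x A matrices are indexed through [enum_rank]. *)
Definition col_vec (n : {ffun letter -> nat}) : 'cV[rat]_#|letter| :=
  \col_i (n (enum_val i))%:R.

Definition is_production_matrix (P : 'M[rat]_#|letter|) : Prop :=
  forall (k : {ffun letter -> nat}) (q : gstate),
    total_kernel [ffun a => (k a)%:Z] -> q \in locally_recurrent ->
    P *m col_vec k = col_vec (msg_vec k q).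

(* Such a matrix exists and is unique as soon as N is locally irreducible. *)
Definition production_matrix : 'M[rat]_#|letter| :=
  xget 0 [set P | is_production_matrix P].

Definition prod_entry (b a : letter) : rat :=
  production_matrix (enum_rank b) (enum_rank a).

Definition is_spectral_radius n (M : 'M[algC]_n) (r : algC) : Prop :=
  (exists2 z, eigenvalue M z & `|z| = r) /\
  (forall z, eigenvalue M z -> `|z| <= r).

(* The eigenvalues of a rational matrix are algebraic, so nothing is lost by
   looking for them in [algC] rather than among all complex numbers. *)
Definition critical : Prop :=
  is_spectral_radius (map_mx ratr production_matrix) 1.

Definition strongly_connected : Prop :=
  forall a b : letter, connect (fun c d => 0 < prod_entry d c) a b.

Definition is_update_rule (u : config -> seq letter) : Prop :=
  forall c, legal (u c) c.

Definition update (u : config -> seq letter) (c : config) : config :=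
  fire_word (u c) c.

(* The average of |u_1|, ..., |u_n| at the letter a; u_(i+1) = u (U^i c). *)
Definition activity_avg (R : realType) (u : config -> seq letter) (c : config)
    (a : letter) (n : nat) : R :=
  n%:R^-1 * \sum_(0 <= i < n) (parikh (u (iter i (update u) c)) a)%:R.

Definition has_activity (R : realType) (u : config -> seq letter)
    (c : config) : Prop :=
  forall a, cvgn (activity_avg R u c a).

Definition activity (R : realType) (u : config -> seq letter) (c : config) :
    {ffun letter -> R} :=
  [ffun a => limn (activity_avg R u c a)].

End AbelianNetwork.

(* Main.v *)
Require Import Defs.
From mathcomp Require Import all_boot all_order all_algebra all_field.
From mathcomp Require Import spectral.
From mathcomp Require Import all_classical all_reals all_analysis.
From mathcomp Require Import zify ring lra.

(* An execution w from c to c' is carried along by the update rule: (H2) and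
   the exchange property of legal executions give, for every n, a legal
   execution from U^n(c) to U^n(c') which together with u_1 ... u_n is a
   rearrangement of w followed by u'_1 ... u'_n.  Hence the activity of c is at
   most that of c', and the converse inequality follows once U^n(c') leads
   back to U^n(c) for some n.

   If r > 0 is a left Perron vector of P, the weight of x under r changes by a
   bounded amount along legal executions, since M_w(q) <= P|w| + O(1).  So
   U^n(c) is eventually periodic.  The word v fired along one period satisfies
   P|v| = |v|, so by strong connectedness it is empty or contains every letter.
   It is empty only at x = 0, by (H1), and then nothing but the empty word is
   legal.  Otherwise a power of v dominates the execution from U^n(c) to
   U^n(c'), and the exchange property leads back to U^n(c).

   The Perron vector is |z| for a left eigenvector z of modulus 1: |z|P >= |z|,
   and a strict inequality would make the powers of P unbounded, whereas
   |tr P^k| <= |A| bounds them by irreducibility. *)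

Set Implicit Arguments.
Unset Strict Implicit.
Unset Printing Implicit Defensive.

Import Order.TTheory GRing.Theory Num.Theory numFieldNormedType.Exports.

Local Open Scope classical_set_scope.
Local Open Scope ring_scope.

(** * Perron vectors *)

Lemma trig_mx_exp (F : fieldType) (n : nat) (T : 'M[F]_n) (k : nat) :
  is_trig_mx T -> is_trig_mx (T ^+ k) /\ forall i, (T ^+ k) i i = T i i ^+ k.
Proof.
move=> trigT; elim: k => [|k [trigTk diagTk]].
  by rewrite expr0; split=> [|i]; rewrite ?scalar_mx_is_trig// !mxE eqxx.
have TS : T ^+ k.+1 = T ^+ k *m T by rewrite exprSr.
split=> [|i]; rewrite TS.
    apply/is_trig_mxP => i j lt_ij; rewrite mxE big1// => l _.
    have [lt_il|le_li] := ltnP i l.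
      by rewrite (is_trig_mxP trigTk) ?mul0r.
    by rewrite [T l j](is_trig_mxP trigT) ?mulr0// (leq_ltn_trans le_li).
rewrite mxE (bigD1 i)//= diagTk exprSr big1 ?addr0// => j jNi.
have [lt_ij|lt_ji|eq_ij] := ltngtP i j.
- by rewrite (is_trig_mxP trigTk) ?mul0r.
- by rewrite [T j i](is_trig_mxP trigT) ?mulr0.
- by rewrite (val_inj eq_ij) eqxx in jNi.
Qed.

(** By Schur, [A ^+ k] is similar to a triangular matrix whose diagonal entries are [k]-th powers of
    eigenvalues of [A]. *)
Lemma norm_mxtrace_exp_le (C : numClosedFieldType) (n : nat) (A : 'M[C]_n)
    (k : nat) :
  (forall z, eigenvalue A z -> `|z| <= 1) -> `|\tr (A ^+ k)| <= n%:R.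
Proof.
case: n => [|n] in A *; first by rewrite /mxtrace big_ord0 normr0.
move=> eigA; have [P /unitarymx_unit unitP trigPA] := Schur A isT.
have [T [trigT AT]] : exists T, is_trig_mx T /\ A = invmx P *m T *m P.
  exists (conjmx P A); split=> //; rewrite conjumx// !mulmxA mulVmx// mul1mx.
  by rewrite -mulmxA mulVmx// mulmx1.
have AkT j : A ^+ j = invmx P *m T ^+ j *m P.
  elim: j => [|j IHj]; first by rewrite !expr0 mulmx1 mulVmx.
  by rewrite !exprSr IHj -!mulmxE {1}AT !mulmxA mulmxK.
have [trigTk diagTk] := trig_mx_exp k trigT.
rewrite AkT mxtrace_mulC mulmxA mulmxV// mul1mx /mxtrace.
apply: le_trans (ler_norm_sum _ _ _) _.
rewrite -[leRHS]mulr1 mulr_natl -[X in _ *+ X]card_ord -sumr_const.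
apply: ler_sum => i _; rewrite diagTk normrX exprn_ile1//.
have /eigenvalueP[v vT v_neq0] : eigenvalue T (T i i).
  rewrite eigenvalue_root_char char_poly_trig// rootE horner_prod.
  by rewrite (bigD1 i)//= !hornerE subrr mul0r.
apply/eigA/eigenvalueP; exists (v *m P).
  by rewrite {1}AT !mulmxA mulmxK// vT scalemxAl.
by apply: contra v_neq0 => /eqP vP0; rewrite -[v](mulmxK unitP) vP0 mul0mx.
Qed.

Section PerronFrobenius.
Variables (n : nat) (A : 'M[algC]_n).
Hypothesis A_ge0 : forall i j, 0 <= A i j.
Hypothesis A_irr : forall i j, exists k, 0 < (A ^+ k) i j.
Hypothesis A_eig : forall z, eigenvalue A z -> `|z| <= 1.

Lemma mx_exp_ge0 k i j : 0 <= (A ^+ k) i j.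
Proof.
elim: k => [|k IHk] in i j *; first by rewrite expr0 mxE ler0n.
by rewrite exprSr mxE sumr_ge0// => l _; rewrite mulr_ge0.
Qed.

(** Irreducibility gives [l] with [(A ^+ l) j i > 0], and [(A ^+ k) i j] times that entry is at most
    [(A ^+ (k + l)) i i], hence at most the trace, hence at most [n]. *)
Lemma mx_exp_bounded : exists C, forall k i j, (A ^+ k) i j <= C.
Proof.
have [l l_gt0] := choice (fun ij : 'I_n * 'I_n => A_irr ij.1 ij.2).
have tr_ge k i : (A ^+ k) i i <= n%:R.
  apply: le_trans (norm_mxtrace_exp_le k A_eig).
  have tr_ge0 : 0 <= \tr (A ^+ k) by apply: sumr_ge0 => j _; exact: mx_exp_ge0.
  rewrite ger0_norm// /mxtrace (bigD1 i)//= lerDl.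
  by apply: sumr_ge0 => j _; exact: mx_exp_ge0.
pose B i j := n%:R / (A ^+ l (j, i)) j i.
have B_ge0 i j : 0 <= B i j by rewrite divr_ge0 ?ler0n// ltW// (l_gt0 (j, i)).
exists (\sum_i \sum_j B i j) => k i j.
apply: (@le_trans _ _ (B i j)).
  rewrite ler_pdivlMr ?(l_gt0 (j, i))//.
  apply: le_trans (tr_ge (k + l (j, i))%N i).
  rewrite exprD mxE (bigD1 j)//= lerDl.
  by apply: sumr_ge0 => m _; rewrite mulr_ge0 ?mx_exp_ge0.
rewrite (bigD1 i)//= (bigD1 j)//= -addrA lerDl.
by rewrite addr_ge0 ?sumr_ge0// => m _; rewrite sumr_ge0.
Qed.

Lemma mulmxr_ge0_le (B : 'M[algC]_n) (v w : 'rV[algC]_n) :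
  (forall i j, 0 <= B i j) -> (forall j, v 0 j <= w 0 j) ->
  forall j, (v *m B) 0 j <= (w *m B) 0 j.
Proof.
by move=> B_ge0 vw j; rewrite !mxE ler_sum// => i _; rewrite ler_wpM2r.
Qed.

(** If [d = wA - w] were nonzero, then for a suitable sum [s] of powers of [A] the vector [y = ws]
    would gain [dsA^k], at least a fixed multiple of [w], at each step [k]. So [yA^k] would grow
    linearly, against the boundedness of the powers. *)
Lemma superinvariant_invariant (w : 'rV[algC]_n) :
  (forall j, 0 <= w 0 j) -> w != 0 -> (forall j, w 0 j <= (w *m A) 0 j) ->
  w *m A = w.
Proof.
move=> w_ge0 w_neq0 w_le.
pose d := w *m A - w.
have d_ge0 j : 0 <= d 0 j by rewrite /d mxE [X in _ + X]mxE subr_ge0.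
apply/eqP; rewrite -subr_eq0; apply/negP => /negP/rV0Pn[i0 di0].
have {}di0 : 0 < d 0 i0 by rewrite lt_def di0 d_ge0.
have [l l_gt0] := choice (A_irr i0).
(* Row [i0] of [s] is positive everywhere, its entry [j] thanks to the term [A ^+ l j]; and [d] is
   positive at [i0]. *)
pose s := \sum_j A ^+ l j.
have commA k : A ^+ k *m s = s *m A ^+ k.
  rewrite /s mulmx_sumr mulmx_suml; apply: eq_bigr => j _.
  by rewrite !mulmxE -!exprD addnC.
have s_ge0 i j : 0 <= s i j.
  by rewrite summxE sumr_ge0// => m _; exact: mx_exp_ge0.
pose y := w *m s.
have y_ge0 j : 0 <= y 0 j by rewrite mxE sumr_ge0// => m _; rewrite mulr_ge0.
have ds_gt0 j : 0 < (d *m s) 0 j.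
  rewrite mxE (bigD1 i0)//= ltr_pwDl//.
    rewrite mulr_gt0// summxE (bigD1 j)//= ltr_pwDl// sumr_ge0// => m _.
    exact: mx_exp_ge0.
  by apply: sumr_ge0 => m _; rewrite mulr_ge0.
have yA k : y *m A ^+ k.+1 - y *m A ^+ k = d *m s *m A ^+ k.
  rewrite /y exprS -mulmxE !mulmxA -mulmxBl -[in w *m s *m A]mulmxA.
  by rewrite -[A in s *m A]expr1 -commA expr1 mulmxA -mulmxBl.
(* The summand [j] alone makes [K] large enough for [w <= K ds] at coordinate [j]. *)
pose K := \sum_j w 0 j / (d *m s) 0 j.
have K_ge0 : 0 <= K by apply: sumr_ge0 => j _; rewrite divr_ge0// ltW.
have w_leK j : w 0 j <= (K *: (d *m s)) 0 j.
  rewrite mxE -ler_pdivrMr// /K (bigD1 j)//= lerDl.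
  by apply: sumr_ge0 => m _; rewrite divr_ge0// ltW.
have w_leX k j : w 0 j <= (w *m A ^+ k) 0 j.
  elim: k => [|k IHk] in j *; first by rewrite expr0 mulmx1.
  apply: le_trans (w_le j) _; rewrite exprSr -mulmxE mulmxA.
  exact: mulmxr_ge0_le.
have lin_growth k j : k%:R * w 0 j <= K * (y *m A ^+ k) 0 j.
  elim: k => [|k IHk]; first by rewrite mul0r mulr_ge0// expr0 mulmx1.
  have -> : y *m A ^+ k.+1 = y *m A ^+ k + d *m s *m A ^+ k.
    by rewrite -yA addrC subrK.
  rewrite mxE mulrDr -addn1 natrD mulrDl mul1r lerD//.
  apply: le_trans (w_leX k j) _.
  apply: le_trans (mulmxr_ge0_le (mx_exp_ge0 k) w_leK j) _.
  by rewrite -scalemxAl mxE.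
have [C A_leC] := mx_exp_bounded.
have yA_le k j : (y *m A ^+ k) 0 j <= \sum_i y 0 i * C.
  by rewrite mxE ler_sum// => i _; rewrite ler_wpM2l.
have /rV0Pn[j0 wj0] := w_neq0.
have {}wj0 : 0 < w 0 j0 by rewrite lt_def wj0 w_ge0.
pose D := K * (\sum_i y 0 i * C) / w 0 j0.
have D_ge k : k%:R <= D.
  rewrite ler_pdivlMr//; apply: le_trans (lin_growth k j0) _.
  by rewrite ler_wpM2l.
have /archi_boundP : 0 <= D := D_ge 0%N.
by move=> /lt_le_trans/(_ (D_ge _)); rewrite ltxx.
Qed.

(** By the triangle inequality the entrywise modulus [w] of a left eigenvector satisfies [w <= wA],
    so it is invariant. Then [w = wA^k] for all [k], and irreducibility spreads one nonzero entry to
    all coordinates. *)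
Lemma perron_row (z : algC) : eigenvalue A z -> `|z| = 1 ->
  exists2 w : 'rV[algC]_n, (forall j, 0 < w 0 j) & w *m A = w.
Proof.
move=> /eigenvalueP[v vA v_neq0] z1.
pose w := map_mx (fun x => `|x|) v.
have wE j : w 0 j = `|v 0 j| by rewrite mxE.
have w_ge0 j : 0 <= w 0 j by rewrite wE.
have /rV0Pn[i vi0] := v_neq0.
have wi0 : w 0 i != 0 by rewrite wE normr_eq0.
have w_neq0 : w != 0 by apply/rV0Pn; exists i.
have wA : w *m A = w.
  apply: superinvariant_invariant => // j.
  have -> : w 0 j = `|(v *m A) 0 j| by rewrite vA wE mxE normrM z1 mul1r.
  rewrite !mxE; apply: le_trans (ler_norm_sum _ _ _) _.
  by apply: ler_sum => k _; rewrite normrM wE (ger0_norm (A_ge0 k j)).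
have wAk k : w *m A ^+ k = w.
  by elim: k => [|k IHk]; rewrite ?expr0 ?mulmx1// exprSr -mulmxE mulmxA IHk.
exists w => // j; have [k Ak] := A_irr i j.
rewrite -(wAk k) mxE (bigD1 i)//= ltr_pwDl//.
  by rewrite mulr_gt0// lt_def wi0 w_ge0.
by apply: sumr_ge0 => m _; rewrite mulr_ge0// mx_exp_ge0.
Qed.

End PerronFrobenius.

(** * The abelian property *)

Section Network.
Variables (G : digraph) (N : finite_abelian_network G).
Implicit Types (a b : letter N) (w : seq (letter N)) (q : gstate N)
  (c d : config N).

Lemma act_letter_in v (a : alphabet N v) q :
  act_letter (Tagged (alphabet N) a) q v = transition a (q v).
Proof. by rewrite /act_letter ffunE /= eqtype.dfwith_in. Qed.

Lemma act_letter_out a q v : tag a != v -> act_letter a q v = q v.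
Proof. by move=> av; rewrite /act_letter ffunE eqtype.dfwith_out. Qed.

Lemma act_letterC a b q :
  act_letter a (act_letter b q) = act_letter b (act_letter a q).
Proof.
apply/ffunP => v; have [av|aNv] := eqVneq (tag a) v; last first.
  rewrite (act_letter_out _ aNv); have [bv|bNv] := eqVneq (tag b) v; last first.
    by rewrite !(act_letter_out _ bNv) act_letter_out.
  case: b bv => [v' b] /= bv; subst v'.
  by rewrite !act_letter_in act_letter_out.
case: a av => [v' a] /= av; subst v'.
have [bv|bNv] := eqVneq (tag b) v; last first.
  by rewrite act_letter_in !(act_letter_out _ bNv) act_letter_in.
case: b bv => [v' b] /= bv; subst v'.
by rewrite !act_letter_in transitionC.
Qed.

(** Letters at different vertices do not change the states that the other one reads; at a common
    vertex this is [message_perm] summed over the outgoing edges. *)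
Lemma msg_letterC a b q l :
  (msg_letter a q l + msg_letter b (act_letter a q) l =
   msg_letter b q l + msg_letter a (act_letter b q) l)%N.
Proof.
rewrite !ffunE; have [ab|aNb] := eqVneq (tag a) (tag b); last first.
  rewrite addnC; congr addn; apply: eq_bigr => e /eqP ev.
    by rewrite act_letter_out// ev.
  by rewrite act_letter_out// ev eq_sym.
case: a b ab => [v a] [v' b] /= ab; subst v'; rewrite -!big_split.
(* Once the vertex is literally [src e], the equality of tags is [erefl] and [untag] can be
   computed. *)
apply: eq_bigr => e /eqP ev; subst v => /=.
rewrite !(untagE _ _ (erefl : tag (existT _ (src e) _) = src e)) /etagged /=.
rewrite -!count_cat -!map_cat !count_map.
have -> : act_letter (existT _ (src e) a) q (src e) = transition a (q (src e)).
  exact: act_letter_in.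
have -> : act_letter (existT _ (src e) b) q (src e) = transition b (q (src e)).
  exact: act_letter_in.
exact/permP/message_perm.
Qed.

Lemma fire1E a c b :
  (fire a c).1 b = c.1 b + (msg_letter a c.2 b)%:Z - (b == a)%:Z.
Proof. by rewrite ffunE [unit_vec _ _]ffunE. Qed.

Lemma fireC a b c : fire a (fire b c) = fire b (fire a c).
Proof.
apply/pair_equal_spec; split; last exact: act_letterC.
apply/ffunP => l; rewrite !fire1E /=.
have := congr1 Posz (msg_letterC a b c.2 l); rewrite !PoszD; lra.
Qed.

Lemma fire_word_cat w1 w2 c :
  fire_word (w1 ++ w2) c = fire_word w2 (fire_word w1 c).
Proof. by elim: w1 c => //= a w1 IH c. Qed.

Lemma legal_cat w1 w2 c :
  legal (w1 ++ w2) c = legal w1 c && legal w2 (fire_word w1 c).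
Proof. by elim: w1 c => //= a w1 IH c; rewrite IH andbA. Qed.

Lemma fire_word_rem a w c :
  a \in w -> fire_word w c = fire_word (a :: rem a w) c.
Proof.
elim: w c => //= b w IH c; rewrite inE eq_sym.
by have [->|bNa] := eqVneq b a => //= /IH ->; rewrite /= fireC.
Qed.

Lemma fire_word_perm w1 w2 c :
  perm_eq w1 w2 -> fire_word w1 c = fire_word w2 c.
Proof.
elim: w1 w2 c => [|a w1 IH] w2 c; first by rewrite perm_sym => /perm_nilP->.
move=> w12; have aw2 : a \in w2 by rewrite -(perm_mem w12) mem_head.
rewrite (fire_word_rem _ aw2) /=; apply: IH; rewrite -(perm_cons a).
exact: perm_trans w12 (perm_to_rem aw2).
Qed.

Lemma fire_ge a b c : b != a -> c.1 b <= (fire a c).1 b.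
Proof. by move=> ba; rewrite fire1E (negbTE ba) /=; lia. Qed.

(** Firing [a] lowers no count but that of [a], so the letters that stood before the first [a]
    remain legal after it. *)
Lemma legal_rem a w c :
  legal w c -> a \in w -> 1 <= c.1 a -> legal (a :: rem a w) c.
Proof.
elim: w c => //= b w IH c /andP[cb lw]; rewrite inE eq_sym.
have [ba|bNa] /= := eqVneq b a; first by subst b => _ ->.
have aNb : a != b by rewrite eq_sym.
move=> aw ca; have /= /andP[_ lrem] := IH _ lw aw (le_trans ca (fire_ge _ aNb)).
by rewrite ca (le_trans cb (fire_ge _ bNa)) fireC.
Qed.

Definition parikh_le w1 w2 := forall a, (count_mem a w1 <= count_mem a w2)%N.

(** The letters of [w1] are pulled to the front of [w2] one after the other; [w] is what then
    remains of [w2]. *)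
Lemma exchange w1 w2 c :
  legal w1 c -> legal w2 c -> parikh_le w1 w2 ->
  exists2 w, legal w (fire_word w1 c) & perm_eq (w1 ++ w) w2.
Proof.
elim: w1 w2 c => [|a w1 IH] w2 c; first by exists w2.
move=> /= /andP[ca lw1] lw2 w12.
have aw2 : a \in w2.
  have := w12 a; rewrite /= eqxx add1n -has_pred1 has_count.
  exact: leq_trans.
have /= /andP[_ lrem] := legal_rem lw2 aw2 ca.
have pw2 := perm_to_rem aw2.
have [|w lw pw] := IH (rem a w2) _ lw1 lrem.
  by move=> b; have := w12 b; rewrite (permP pw2 _) /= leq_add2l.
by exists w => //; rewrite (permPr pw2) /= perm_cons.
Qed.

Lemma fire_wordE w c :
  fire_word w c =
  ([ffun b => c.1 b + (msg_word w c.2 b)%:Z - (count_mem b w)%:Z],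
   act_word w c.2).
Proof.
elim: w c => [|a w IH] c.
  by case: c => x q; congr pair; apply/ffunP => b; rewrite !ffunE addr0 subr0.
rewrite /= IH; apply/pair_equal_spec; split=> //; apply/ffunP => b.
rewrite [LHS]ffunE [RHS]ffunE fire1E [in RHS]ffunE /=.
rewrite !PoszD eq_sym; lra.
Qed.

Lemma act_word_perm w1 w2 q : perm_eq w1 w2 -> act_word w1 q = act_word w2 q.
Proof.
by move=> /fire_word_perm-/(_ ([ffun=> 0], q)); rewrite !fire_wordE => -[].
Qed.

Lemma msg_word_perm w1 w2 q : perm_eq w1 w2 -> msg_word w1 q = msg_word w2 q.
Proof.
move=> w12; have := fire_word_perm ([ffun=> 0], q) w12.
rewrite !fire_wordE => -[/ffunP e _]; apply/ffunP => b; move: (e b).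
rewrite !ffunE (permP w12 _) /=; lia.
Qed.

Lemma act_word_cat w1 w2 q :
  act_word (w1 ++ w2) q = act_word w2 (act_word w1 q).
Proof. by elim: w1 q => //= a w1 IH q. Qed.

Lemma msg_word_cat w1 w2 q b :
  msg_word (w1 ++ w2) q b = (msg_word w1 q b + msg_word w2 (act_word w1 q) b)%N.
Proof.
elim: w1 q => [|a w1 IH] q /=; first by rewrite [X in (X + _)%N]ffunE.
by rewrite [LHS]ffunE [X in _ = (X + _)%N]ffunE IH addnA.
Qed.

Lemma act_wordC w1 w2 q :
  act_word w1 (act_word w2 q) = act_word w2 (act_word w1 q).
Proof.
by rewrite -!act_word_cat (act_word_perm _ (permEl (perm_catC _ _))).
Qed.

Lemma msg_wordC w1 w2 q b :
  (msg_word w1 q b + msg_word w2 (act_word w1 q) b =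
   msg_word w2 q b + msg_word w1 (act_word w2 q) b)%N.
Proof.
by rewrite -!msg_word_cat (msg_word_perm _ (permEl (perm_catC _ _))).
Qed.

Lemma legal_ge0 w c : (forall a, 0 <= c.1 a) -> legal w c ->
  forall a, 0 <= (fire_word w c).1 a.
Proof.
elim: w c => //= a w IH c c_ge0 /andP[ca lw]; apply: IH => // b.
have [->|bNa] := eqVneq b a; last exact: le_trans (c_ge0 b) (fire_ge _ bNa).
rewrite fire1E eqxx; move: (msg_letter _ _ _) (c.1 a) ca => m x; lia.
Qed.
End Network.

(** * Recurrent states *)

Lemma nat_pigeonhole (T : finType) (F : nat -> T) :
  exists i, exists2 p, (0 < p)%N & F (i + p)%N = F i.
Proof.
have /injectivePn[i [j ij Fij]] : ~~ injectiveb (fun k : 'I_#|T|.+1 => F k).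
  by apply/negP => /injectiveP /leq_card; rewrite card_ord ltnn.
wlog lt_ij : i j ij Fij / (i < j)%N.
  move=> wl; have [|lt_ji|/val_inj eq_ij] := ltngtP i j; first exact: wl.
    by apply: (wl j i) => //; rewrite eq_sym.
  by rewrite eq_ij eqxx in ij.
by exists i, (j - i)%N; rewrite ?subn_gt0// subnKC// ltnW.
Qed.

Lemma iter_idempotent (T : finType) (f : T -> T) :
  exists2 n, (0 < n)%N & forall x, iter n f (iter n f x) = iter n f x.
Proof.
pose F k : {ffun T -> T} := [ffun x => iter k f x].
have [i [p p_gt0 Fip]] := nat_pigeonhole F.
have per k m x : iter (i + k + m * p) f x = iter (i + k) f x.
  elim: m => [|m IHm]; first by rewrite addn0.
  have iterFip y : iter (i + p) f y = iter i f y.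
    by move/ffunP/(_ y): Fip; rewrite !ffunE.
  have -> : (i + k + m.+1 * p = (k + m * p) + (i + p))%N by rewrite mulSn; lia.
  by rewrite iterD iterFip -iterD -IHm; congr iter; lia.
(* Any multiple of the period [p] that is at least the preperiod [i] works; the factor [i.+1] also
   keeps it positive. *)
exists (i.+1 * p)%N; first by rewrite muln_gt0.
move=> x; rewrite -iterD.
have i_le : (i <= i.+1 * p)%N by rewrite (leq_trans (leqnSn i))// leq_pmulr.
by have := per (i.+1 * p - i)%N i.+1 x; rewrite subnKC.
Qed.

Lemma perm_eq_count (T : eqType) (s1 s2 : seq T) :
  (forall x, count_mem x s1 = count_mem x s2) -> perm_eq s1 s2.
Proof. by move=> e; apply/allP => x _; apply/eqP/e. Qed.

Section Recurrence.
Variables (G : digraph) (N : finite_abelian_network G).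
Implicit Types (a b : letter N) (w : seq (letter N)) (q : gstate N).

Lemma count_word_of (n : {ffun letter N -> nat}) a :
  count_mem a (word_of n) = n a.
Proof.
rewrite /word_of count_flatten -map_comp sumnE big_map.
under eq_bigr do rewrite /= count_nseq /=.
rewrite (bigD1_seq a) ?mem_enum ?enum_uniq//= eqxx mul1n big1 ?addn0// => b.
by move=> /negbTE->.
Qed.

Lemma word_of_parikh w : perm_eq (word_of (parikh w)) w.
Proof. by apply: perm_eq_count => a; rewrite count_word_of ffunE. Qed.

Lemma act_word_nseq k a q : act_word (nseq k a) q = iter k (act_letter a) q.
Proof.
by elim: k q => //= k IH q; rewrite IH -iterSr.
Qed.

Lemma big_ffun_comp_monoid (s : seq {ffun gstate N -> gstate N})
    (P : pred {ffun gstate N -> gstate N}) :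
  (forall f, P f -> transition_monoid f) ->
  exists w, forall q,
    (\big[@ffun_comp _ N/[ffun q => q]]_(f <- s | P f) f) q = act_word w q.
Proof.
move=> P_monoid; elim/big_rec: _ => [|f x Pf [w xw]].
  by exists [::] => q; rewrite ffunE.
have [w' ->] := P_monoid _ Pf; exists (w ++ w') => q.
by rewrite !ffunE xw act_word_cat.
Qed.

(** The factors commute, so [f] can be moved to its own occurrence in the product, where idempotence
    absorbs it. *)
Lemma big_ffun_comp_absorb (s : seq {ffun gstate N -> gstate N})
    (P : pred {ffun gstate N -> gstate N}) (f : {ffun gstate N -> gstate N}) :
  (forall g, P g -> transition_monoid g) -> P f -> ffun_comp f f = f ->
  f \in s -> forall q,
  f ((\big[@ffun_comp _ N/[ffun q => q]]_(g <- s | P g) g) q) =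
  (\big[@ffun_comp _ N/[ffun q => q]]_(g <- s | P g) g) q.
Proof.
move=> P_monoid Pf ff; elim: s => //= g s IH.
rewrite inE big_cons => fs q; have [eq_fg|fNg] := eqVneq f g.
  by rewrite -eq_fg Pf ffunE -[in RHS]ff [RHS]ffunE.
move: fs; rewrite (negbTE fNg) /= => /IH{}IH.
case: ifP => [Pg|_]; last exact: IH.
rewrite ffunE; set h := \big[_/_]_(_ <- _ | _) _.
have [wf fE] := P_monoid _ Pf; have [wg gE] := P_monoid _ Pg.
have fgC x : f (g x) = g (f x) by rewrite fE gE !ffunE act_wordC.
by rewrite fgC IH.
Qed.

Lemma min_idempotent_word :
  exists w, forall q, min_idempotent N q = act_word w q.
Proof.
by apply: big_ffun_comp_monoid => f /andP[/asboolP].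
Qed.

Lemma act_word_recurrent :
  exists w, forall q, act_word w q \in locally_recurrent N.
Proof.
have [w wE] := min_idempotent_word.
by exists w => q; rewrite -wE; apply/imsetP; exists q.
Qed.

Definition recurrent_periods (n : letter N -> nat) :=
  forall a, (0 < n a)%N /\
    forall q, q \in locally_recurrent N -> act_word (nseq (n a) a) q = q.

(** Some positive power of each [t_a] is idempotent, hence a factor of the product [e], and so it
    fixes every state of [eQ]. *)
Lemma recurrent_periods_exist : exists n, recurrent_periods n.
Proof.
suff /choice[n nP] : forall a, exists n, (0 < n)%N /\
    forall q, q \in locally_recurrent N -> act_word (nseq n a) q = q.
  by exists n.
move=> a; have [n n_gt0 n_idem] := iter_idempotent (@act_letter _ N a).
exists n; split=> // _ /imsetP[q _ ->].
pose f : {ffun gstate N -> gstate N} := [ffun q => act_word (nseq n a) q].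
have ff : ffun_comp f f = f.
  by apply/ffunP => x; rewrite !ffunE !act_word_nseq n_idem.
have fE x : act_word (nseq n a) x = f x by rewrite ffunE.
rewrite fE; apply: big_ffun_comp_absorb => //; last exact: mem_index_enum.
  by move=> g /andP[/asboolP].
by rewrite ff eqxx andbT; apply/asboolP; exists (nseq n a).
Qed.

End Recurrence.

(** * The production matrix *)

Section Production.
Variables (G : digraph) (N : finite_abelian_network G).
Implicit Types (a b : letter N) (w : seq (letter N)) (q : gstate N)
  (c d : config N).

Lemma act_word_flatten_fix (ws : seq (seq (letter N))) q :
  {in ws, forall w, act_word w q = q} -> act_word (flatten ws) q = q.
Proof.
elim: ws => //= w ws IH fix_w; rewrite act_word_cat fix_w ?mem_head// IH//.
by move=> w' w'ws; rewrite fix_w// inE w'ws orbT.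
Qed.

Lemma act_vec_fix (n : {ffun letter N -> nat}) q :
  (forall a, act_word (nseq (n a) a) q = q) -> act_vec n q = q.
Proof.
by move=> fix_n; apply: act_word_flatten_fix => _ /mapP[a _ ->].
Qed.

Lemma iter_fix_dvd (T : Type) (f : T -> T) (m k : nat) x :
  iter m f x = x -> (m %| k)%N -> iter k f x = x.
Proof.
move=> fx /dvdnP[j ->]; elim: j => // j IH.
by rewrite mulSn addnC iterD fx.
Qed.

(** Each block of equal letters in [word_of k] fixes the locally recurrent states. This yields
    enough kernel vectors to compute with [P]. *)
Lemma total_kernel_dvd (n : letter N -> nat) (k : {ffun letter N -> nat}) :
  recurrent_periods n -> (forall a, (n a %| k a)%N) ->
  total_kernel [ffun a => (k a)%:Z].
Proof.
move=> n_per n_dvd q q_rec.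
rewrite !act_vec_fix// => a; rewrite !ffunE.
  by rewrite (max_idPr _) ?normr0 ?oppr_le0.
rewrite (max_idPl _)// absz_nat act_word_nseq.
apply: iter_fix_dvd (n_dvd a); rewrite -act_word_nseq; exact: (n_per a).2.
Qed.

Hypothesis prodP : is_production_matrix (production_matrix N).

(** The coordinate [b] of [P|w|]. *)
Definition prod_vec w b : rat :=
  \sum_a prod_entry b a * (count_mem a w)%:R.

Lemma msg_word_recurrent (n : letter N -> nat) w q b :
  recurrent_periods n -> (forall a, (n a %| count_mem a w)%N) ->
  q \in locally_recurrent N ->
  (msg_word w q b)%:R = prod_vec w b.
Proof.
move=> n_per n_dvd q_rec.
have kerw : total_kernel [ffun a => (parikh w a)%:Z].
  by apply: (total_kernel_dvd n_per) => a; rewrite ffunE.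
have /matrixP/(_ (enum_rank b) 0) := prodP kerw q_rec.
rewrite !mxE /msg_vec enum_rankK (msg_word_perm _ (word_of_parikh w)) => <-.
rewrite (reindex (@enum_rank (letter N))) /=; last first.
  by apply: onW_bij; exact: enum_rank_bij.
by apply: eq_bigr => a _; rewrite mxE enum_rankK ffunE.
Qed.

(** For the word made of [n a] copies of [a], [n a] times the entry is a number of messages. A
    locally recurrent state is reached from [q0]. *)
Lemma prod_entry_ge0 b a (q0 : gstate N) : 0 <= prod_entry b a.
Proof.
have [n n_per] := recurrent_periods_exist N.
have [z z_rec] := act_word_recurrent N.
have := msg_word_recurrent (w := nseq (n a) a) b n_per _ (z_rec q0).
rewrite /prod_vec (bigD1 a)//= big1 => [|a' a'Na]; last first.
  by rewrite count_nseq /= eq_sym (negbTE a'Na) mulr0.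
rewrite addr0 count_nseq /= eqxx mul1n => msgE.
have n_gt0 : 0 < (n a)%:R :> rat by rewrite ltr0n (n_per a).1.
rewrite -(pmulr_lge0 _ n_gt0) -msgE ?ler0n// => a'.
by rewrite count_nseq /=; have [->|] := eqVneq; rewrite ?mul1n ?mul0n.
Qed.

Lemma msg_word_le : exists M, forall w q b, (msg_word w q b <= size w * M)%N.
Proof.
exists (\max_(a : letter N) \max_(q : gstate N) \max_(b : letter N)
  msg_letter a q b)%N => w q b.
elim: w q => [|a w IH] q /=; rewrite ffunE// mulSn leq_add//.
apply: leq_trans (leq_bigmax a); apply: leq_trans (leq_bigmax q).
exact: (leq_bigmax b).
Qed.

Lemma size_word_of (n : {ffun letter N -> nat}) :
  size (word_of n) = (\sum_a n a)%N.
Proof.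
rewrite size_flatten /shape -map_comp sumnE big_map big_enum.
by apply: eq_bigr => a _; rewrite /= size_nseq.
Qed.

(** Equality holds at a locally recurrent state for counts divisible by the periods. Passing to such
    a state through [z] costs at most the messages of [z]; rounding the counts down leaves a
    remainder of bounded length, and only lowers [P|w|] since [P] is nonnegative. *)
Lemma msg_word_le_prod : exists C : nat, forall w q b,
  (msg_word w q b)%:R <= prod_vec w b + C%:R.
Proof.
have [n n_per] := recurrent_periods_exist N.
have [z z_rec] := act_word_recurrent N.
have [M msg_leM] := msg_word_le.
exists ((size z + \sum_a n a) * M)%N => w q b.
pose k := [ffun a => (count_mem a w %/ n a * n a)%N].
pose r := [ffun a => (count_mem a w %% n a)%N].
have w_kr : perm_eq w (word_of k ++ word_of r).
  apply: perm_eq_count => a; rewrite count_cat !count_word_of !ffunE.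
  exact: divn_eq.
have msg_q : (msg_word w q b <= size z * M + msg_word w (act_word z q) b)%N.
  apply: leq_trans (leq_addr (msg_word z (act_word w q) b) _) _.
  by rewrite msg_wordC leq_add2r.
have msg_r q' : (msg_word (word_of r) q' b <= (\sum_a n a) * M)%N.
  apply: leq_trans (msg_leM _ _ _) _; rewrite leq_mul2r size_word_of.
  apply/orP; right; apply: leq_sum => a _; rewrite ffunE.
  by rewrite ltnW// ltn_mod (n_per a).1.
rewrite (msg_word_perm (act_word z q) w_kr) msg_word_cat in msg_q.
have {msg_q} : (msg_word w q b <= msg_word (word_of k) (act_word z q) b +
    (size z + \sum_a n a) * M)%N.
  apply: leq_trans msg_q _; rewrite addnCA leq_add2l mulnDl leq_add2l.
  exact: msg_r.
rewrite -(ler_nat rat) natrD => /le_trans; apply; rewrite lerD2r.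
rewrite (msg_word_recurrent b n_per) => [|a|]; last exact: z_rec.
  rewrite ler_sum// => a _; rewrite ler_wpM2l ?(prod_entry_ge0 _ _ q)//.
  by rewrite ler_nat count_word_of ffunE leq_divM.
by rewrite count_word_of ffunE dvdn_mull.
Qed.

(** Repeating [w] makes its counts divisible by all periods. The repetition [ws] fixes [q], so
    commuting it with [z] shows that it sends the same messages from [q] as from a locally recurrent
    state, namely [P|ws|]. *)
Lemma cycle_prod_vec w q b : act_word w q = q ->
  (forall a, msg_word w q a = count_mem a w) ->
  prod_vec w b = (count_mem b w)%:R.
Proof.
move=> act_w msg_w.
have [n n_per] := recurrent_periods_exist N.
have [z z_rec] := act_word_recurrent N.
pose m := (\prod_a n a)%N.
have m_gt0 : (0 < m)%N by rewrite prodn_gt0// => a; exact: (n_per a).1.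
pose ws := flatten (nseq m w).
have act_ws : act_word ws q = q.
  by apply: act_word_flatten_fix => w' /nseqP[-> _].
have count_ws a : count_mem a ws = (m * count_mem a w)%N.
  by rewrite count_flatten map_nseq sumn_nseq mulnC.
have msg_ws : msg_word ws q b = (m * count_mem b w)%N.
  rewrite /ws; elim: (m) => [|j IH]; first by rewrite mul0n /= ffunE.
  by rewrite /= msg_word_cat act_w IH msg_w mulSn.
have := msg_wordC ws z q b; rewrite act_ws addnC => /addnI.
rewrite msg_ws => /(congr1 (fun k => k%:R : rat)).
rewrite (msg_word_recurrent b n_per) => [|a|]; last exact: z_rec; last first.
  by rewrite count_ws dvdn_mulr// /m (bigD1 a)//= dvdn_mulr.
rewrite /prod_vec natrM; under eq_bigr do rewrite count_ws natrM mulrCA.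
rewrite -mulr_sumr => /mulfI->//.
by rewrite pnatr_eq0 -lt0n.
Qed.

(** Since [P|w| = |w|] and [P] is nonnegative, the set of letters of [w] is closed under the edges
    of the production digraph. *)
Lemma cycle_full_support w q : strongly_connected N -> act_word w q = q ->
  (forall a, msg_word w q a = count_mem a w) -> w != [::] ->
  forall a, a \in w.
Proof.
move=> conn act_w msg_w; case: w => // a0 w in act_w msg_w * => _ a.
move: (a0 :: w) act_w msg_w (mem_head a0 w) => {}w act_w msg_w a0w.
have /connectP[p a0p ->] := conn a0 a.
elim: p a0 a0w a0p => //= b p IH a0 a0w /andP[a0b bp].
apply: IH bp; rewrite -has_pred1 has_count -(ltr_nat rat).
rewrite -(cycle_prod_vec b act_w msg_w) /prod_vec (bigD1 a0)//= ltr_pwDl//.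
  by rewrite mulr_gt0// ltr0n -has_count has_pred1.
by apply: sumr_ge0 => c _; rewrite mulr_ge0 ?(prod_entry_ge0 _ _ q).
Qed.

End Production.

(** * Boundedness of legal executions in critical networks *)

Section Critical.
Variables (G : digraph) (N : finite_abelian_network G).
Implicit Types (a b : letter N) (w : seq (letter N)) (q : gstate N)
  (c d : config N).

(* A network without production matrix has [production_matrix N = 0], whose
   spectral radius is not 1. *)
Lemma critical_production_matrix :
  critical N -> is_production_matrix (production_matrix N).
Proof.
case=> -[z /eigenvalueP[v vP v_neq0] z1] _; rewrite /production_matrix in vP *.
case: xgetP vP => [P -> //|_] /eqP; rewrite map_mx0 mulmx0 eq_sym scaler_eq0.
by rewrite (negbTE v_neq0) orbF -normr_eq0 z1 oner_eq0.
Qed.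

Hypothesis crit : critical N.
Hypothesis conn : strongly_connected N.

Lemma perron_vector (q0 : gstate N) : exists2 r : letter N -> algC,
  (forall a, 0 < r a) & forall a, \sum_b r b * ratr (prod_entry b a) = r a.
Proof.
have prodP := critical_production_matrix crit.
have [[z z_eig z1] eig_le1] := crit.
pose A : 'M[algC]_#|letter N| := map_mx ratr (production_matrix N).
have AE b a : A (enum_rank b) (enum_rank a) = ratr (prod_entry b a).
  by rewrite mxE.
have A_ge0 i j : 0 <= A i j.
  by rewrite -[i]enum_valK -[j]enum_valK AE ler0q (prod_entry_ge0 prodP).
(* A path of length [k] from [j] to [i] makes this entry positive: edges run from column index to
   row index. *)
have A_irr i j : exists k, 0 < (A ^+ k) i j.
  rewrite -[i]enum_valK -[j]enum_valK.
  have /connectP[p jp ->] := conn (enum_val j) (enum_val i).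
  elim: p (enum_val j) jp => [a _|b p IH a /= /andP[ab bp]].
    by exists 0%N; rewrite expr0 mxE eqxx ltr01.
  have [k Ak_gt0] := IH _ bp; exists k.+1.
  rewrite exprSr mxE (bigD1 (enum_rank b))//= ltr_pwDl//.
    by rewrite mulr_gt0// AE ltr0q.
  by apply: sumr_ge0 => l _; rewrite mulr_ge0 ?mx_exp_ge0.
have [r r_gt0 rA] := perron_row A_ge0 A_irr eig_le1 z_eig z1.
exists (fun a => r 0 (enum_rank a)) => // a.
rewrite -[in RHS]rA mxE (reindex (@enum_rank (letter N))) /=; last first.
  by apply: onW_bij; exact: enum_rank_bij.
by apply: eq_bigr => b _; rewrite AE.
Qed.

Lemma legal_bounded c : (forall a, 0 <= c.1 a) -> exists B : nat,
  forall w, legal w c -> forall a, (fire_word w c).1 a <= B%:Z.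
Proof.
move=> c_ge0; have prodP := critical_production_matrix crit.
have [r r_gt0 rP] := perron_vector c.2.
have [C msg_le] := msg_word_le_prod prodP.
pose D := \sum_b r b * ((c.1 b)%:~R + C%:R).
have D_ge w : legal w c -> \sum_b r b * ((fire_word w c).1 b)%:~R <= D.
  move=> lw; rewrite fire_wordE /=.
  (* The two terms added to [D] cancel after weighting by [r], because [rP = r]; the comparison can
     then be made letter by letter. *)
  have -> : D = \sum_b r b * ((c.1 b)%:~R + C%:R + ratr (prod_vec w b)
      - (count_mem b w)%:R).
    under [RHS]eq_bigr do rewrite -addrA mulrDr.
    rewrite big_split /= [X in _ = _ + X](_ : _ = 0) ?addr0//.
    under eq_bigr do rewrite mulrBr.
    rewrite big_split /= sumrN; apply/eqP; rewrite subr_eq0; apply/eqP.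
    under eq_bigr do rewrite rmorph_sum mulr_sumr.
    rewrite exchange_big /=; apply: eq_bigr => a _.
    rewrite -[in RHS](rP a) mulr_suml; apply: eq_bigr => b _.
    by rewrite rmorphM /= ratr_nat mulrA.
  apply: ler_sum => b _; rewrite ler_wpM2l ?(ltW (r_gt0 b))// ffunE.
  rewrite rmorphB rmorphD /= lerD2r -!addrA lerD2l.
  rewrite -[C%:R]ratr_nat -rmorphD /= -pmulrn -[X in X <= _]ratr_nat ler_rat.
  rewrite addrC; exact: msg_le.
(* As all counts stay nonnegative, the weighted count of one letter is at most the total weight. *)
pose K a := D / r a.
have K_ge w a : legal w c -> ((fire_word w c).1 a)%:~R <= K a.
  move=> lw; rewrite ler_pdivlMr// mulrC; apply: le_trans (D_ge w lw).
  rewrite (bigD1 a)//= lerDl sumr_ge0// => b _.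
  by rewrite mulr_ge0 ?ler0z ?(legal_ge0 c_ge0)// ltW.
exists (\max_a Num.bound (K a))%N => w lw a.
rewrite -(ler_int algC); apply: le_trans (K_ge w a lw) _.
have K_ge0 : 0 <= K a.
  by apply: le_trans (K_ge [::] a isT); rewrite ler0z.
apply: le_trans (ltW (archi_boundP K_ge0)) _.
by rewrite ler_nat (leq_bigmax a).
Qed.

End Critical.

(** * Update rules *)

Section Dynamics.
Variables (G : digraph) (N : finite_abelian_network G).
Variable u : config N -> seq (letter N).
Hypothesis u_rule : is_update_rule u.
Implicit Types (a b : letter N) (w : seq (letter N)) (c d : config N).
Local Notation U := (update u).

Fixpoint run c n : seq (letter N) :=
  if n is m.+1 then run c m ++ u (iter m U c) else [::].

Lemma fire_run c n : fire_word (run c n) c = iter n U c.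
Proof. by elim: n => //= n IH; rewrite fire_word_cat IH. Qed.

Lemma legal_run c n : legal (run c n) c.
Proof. by elim: n => //= n IH; rewrite legal_cat IH fire_run u_rule. Qed.

Lemma runD c m n : run c (m + n) = run c m ++ run (iter m U c) n.
Proof.
elim: n => [|n IH]; first by rewrite addn0 cats0.
by rewrite addnS /= IH catA [(m + n)%N]addnC iterD.
Qed.

Lemma run_nil c n : (0 < n)%N -> run c n = [::] -> u c = [::].
Proof. by case: n => // n _; rewrite -add1n runD /=; case: (u c). Qed.

(** Starting one step later on the cycle moves the first update word of the period to its end. *)
Lemma run_cycle d p k :
  iter p U d = d -> perm_eq (run (iter k U d) p) (run d p).
Proof.
move=> Upd; elim: k => //= k IH; apply: perm_trans IH; set d' := iter k U d.
have Upd' : iter p U d' = d' by rewrite /d' -iterD addnC iterD Upd.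
have := runD d' 1 p; rewrite addnC runD Upd' /= => e.
by rewrite -(perm_cat2l (u d')) -e perm_catC.
Qed.

Lemma iter_update_ge0 c n : (forall a, 0 <= c.1 a) ->
  forall a, 0 <= (iter n U c).1 a.
Proof. by move=> c_ge0 a; rewrite -fire_run legal_ge0 ?legal_run. Qed.

Lemma update_eventually_periodic c (B : nat) : (forall a, 0 <= c.1 a) ->
  (forall w, legal w c -> forall a, (fire_word w c).1 a <= B%:Z) ->
  exists i, exists2 p, (0 < p)%N & iter (i + p) U c = iter i U c.
Proof.
move=> c_ge0 c_le.
(* Along the orbit all counts lie between [0] and [B], so [inord] loses nothing and [F] encodes the
   orbit in a finite type. *)
pose F n : {ffun letter N -> 'I_B.+1} * gstate N :=
  ([ffun a => inord `|(iter n U c).1 a|%N], (iter n U c).2).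
have FK n : [ffun a => (F n).1 a : int] = (iter n U c).1.
  apply/ffunP => a; rewrite !ffunE inordK.
    by rewrite gez0_abs ?iter_update_ge0.
  have := c_le _ (legal_run c n) a; have := iter_update_ge0 n c_ge0 a.
  by rewrite fire_run; move: ((iter n U c).1 a) => x; lia.
have [i [p p_gt0 Fip]] := nat_pigeonhole F.
exists i, p => //; rewrite [LHS]surjective_pairing [RHS]surjective_pairing.
by congr pair; [rewrite -!FK Fip | exact: (congr1 snd Fip)].
Qed.

(** * Comparison of the runs of two configurations *)

Section Monotone.
Hypothesis H2 : forall a c c', executes [:: a] c c' ->
  forall b, (parikh (u c) b <= parikh [:: a] b + parikh (u c') b)%N.

Lemma update_word_le w c :
  legal w c -> parikh_le (u c) (w ++ u (fire_word w c)).
Proof.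
elim: w c => [|a w IH] c; first by move=> _ b.
move=> /= /andP[ca lw] b.
have a_exec : executes [:: a] c (fire a c) by split; rewrite //= ca.
have := H2 a_exec b; rewrite !ffunE /= addn0 => /leq_trans; apply.
by rewrite leq_add2l; exact: IH.
Qed.

(** In the induction [w'] leads from [U^n(c)] to [U^n(c')], where [c'] is the end of [w]. By
    [update_word_le], [exchange] lets the update word of [U^n(c)] be fired first, and what remains
    is the next [w']. *)
Lemma follow w c n : legal w c ->
  exists2 w', legal w' (iter n U c) &
    perm_eq (run c n ++ w') (w ++ run (fire_word w c) n).
Proof.
move=> lw; elim: n => [|n [w' lw' perm_w']] /=.
  by exists w; rewrite ?cats0.
have fire_w' : fire_word w' (iter n U c) = iter n U (fire_word w c).
  have := fire_word_perm c perm_w'.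
  by rewrite !fire_word_cat !fire_run.
have [||w3 lw3 perm_w3] := @exchange _ _ (u (iter n U c))
  (w' ++ u (iter n U (fire_word w c))) (iter n U c) (u_rule _).
- by rewrite legal_cat lw' fire_w' u_rule.
- by rewrite -fire_w'; exact: update_word_le.
exists w3 => //; rewrite -catA (permPl (perm_cat (perm_refl _) perm_w3)).
by rewrite !catA perm_cat.
Qed.

Lemma run_le w c n b : legal w c ->
  (count_mem b (run c n) <= size w + count_mem b (run (fire_word w c) n))%N.
Proof.
move=> lw; have [w' _ /permP/(_ (pred1 b))] := follow n lw.
rewrite !count_cat => e; apply: leq_trans (leq_addr (count_mem b w') _) _.
by rewrite e leq_add2r count_size.
Qed.

Hypothesis H1 : forall c, (forall a, 0 <= c.1 a) -> c.1 <> 0 -> u c <> [::].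
Hypothesis conn : strongly_connected N.
Hypothesis crit : critical N.

Lemma cycle_return d p w : (forall a, 0 <= d.1 a) -> (0 < p)%N ->
  iter p U d = d -> legal w d -> exists2 w', legal w' (fire_word w d) &
    fire_word w' (fire_word w d) = d.
Proof.
move=> d_ge0 p_gt0 Upd lw; have [v0|vN0] := eqVneq (run d p) [::].
  have d0 : d.1 = 0.
    have [//|/eqP /(H1 d_ge0) ] := eqVneq d.1 0.
    by rewrite (run_nil p_gt0 v0).
  by case: w lw => [|a w] /=; [exists [::]|rewrite d0 ffunE].
move: (run d p) (legal_run d p) (fire_run d p) vN0; rewrite Upd => v lv fv vN0.
have v_full a : a \in v.
  have act_v : act_word v d.2 = d.2 by rewrite -[in RHS]fv fire_wordE.
  have prodP := critical_production_matrix crit.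
  apply: (cycle_full_support prodP conn act_v) => //.
  move=> b; have := congr1 (fun d' => d'.1 b) fv.
  by rewrite fire_wordE /= ffunE; move: (msg_word _ _ _) (d.1 b) => m x; lia.
pose vk k := flatten (nseq k v).
have vkP k : legal (vk k) d /\ fire_word (vk k) d = d.
  elim: k => //= k [lvk fvk]; split.
    by rewrite legal_cat lv fv.
  by rewrite fire_word_cat fv.
(* With [size w] copies of [v], every letter occurs at least [size w] times, hence at least as often
   as in [w]. *)
have [l_vk f_vk] := vkP (size w).
have [|w' lw' perm_w'] := exchange lw l_vk.
  move=> a; rewrite count_flatten map_nseq sumn_nseq.
  apply: leq_trans (count_size _ _) _; rewrite leq_pmull//.
  by rewrite -has_count has_pred1.
by exists w' => //; rewrite -fire_word_cat (fire_word_perm _ perm_w').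
Qed.

(** The converse of [run_le]: once [U^i(c)] lies on its cycle, [w2] leads back to it from the
    corresponding iterate of the other run, and [run_le] applies along [w2]. *)
Lemma run_ge w c : (forall a, 0 <= c.1 a) -> legal w c -> exists K, forall n b,
  (count_mem b (run (fire_word w c) n) <= K + count_mem b (run c n))%N.
Proof.
move=> c_ge0 lw; have [B c_le] := legal_bounded crit conn c_ge0.
have [i [p p_gt0 per]] := update_eventually_periodic c_ge0 c_le.
have [w1 lw1 perm_w1] := follow i lw.
have fire_w1 : fire_word w1 (iter i U c) = iter i U (fire_word w c).
  by have := fire_word_perm c perm_w1; rewrite !fire_word_cat !fire_run.
have [||||w2 lw2 fire_w2] := @cycle_return (iter i U c) p w1.
- exact: iter_update_ge0.
- by [].
- by rewrite -iterD addnC.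
- by [].
rewrite fire_w1 in lw2 fire_w2.
(* The first summand pays for the first [i] updates, the second for the return along [w2]. *)
exists (size (run (fire_word w c) i) + size w2)%N => n b.
have [le_ni|lt_in] := leqP n i.
  apply: (@leq_trans (count_mem b (run (fire_word w c) i))).
    by rewrite -(subnKC le_ni) runD count_cat leq_addr.
  by apply: leq_trans (count_size _ _) _; rewrite -addnA leq_addr.
rewrite -(subnKC (ltnW lt_in)) !runD !count_cat -addnA leq_add ?count_size//.
have := run_le (n - i) b lw2; rewrite fire_w2 => /leq_trans; apply.
by rewrite leq_add2l leq_addl.
Qed.

End Monotone.
End Dynamics.

(** * Activity *)

Section Averages.
Variable R : realType.
Implicit Types (f g : nat -> R).

Lemma cvg_avg_bounded_diff f g (K l : R) : (forall n, `|f n - g n| <= K) ->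
  n%:R^-1 * g n @[n --> \oo] --> l -> n%:R^-1 * f n @[n --> \oo] --> l.
Proof.
move=> fgK g_cvg.
have inv_cvg : (n%:R^-1 : R) @[n --> \oo] --> (0 : R).
  by rewrite -cvg_shiftS; exact: cvg_harmonic.
have K_cvg : n%:R^-1 * K @[n --> \oo] --> (0 : R).
  by rewrite -[X in _ --> X](mul0r K); exact: (cvgM inv_cvg (cvg_cst K)).
have diff_cvg : n%:R^-1 * (f n - g n) @[n --> \oo] --> (0 : R).
  apply: (@squeeze_cvgr _ _ _ _ (fun n => - (n%:R^-1 * K))
    (fun n => n%:R^-1 * K)).
  - apply: nearW => n; rewrite -ler_norml normrM ger0_norm ?invr_ge0 ?ler0n//.
    by rewrite ler_wpM2l// invr_ge0.
  - by rewrite -[X in _ --> X]oppr0; exact: cvgN.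
  - exact: K_cvg.
rewrite -[l]addr0.
have -> : (fun n => n%:R^-1 * f n) =
    (fun n => n%:R^-1 * g n + n%:R^-1 * (f n - g n)).
  by apply/funext => n; rewrite -mulrDr addrC subrK.
exact: cvgD.
Qed.

Lemma eventually_periodic_bounded f i p : (0 < p)%N ->
  (forall n, (i <= n)%N -> f (n + p)%N = f n) ->
  exists K, forall n, `|f n| <= K.
Proof.
move=> p_gt0 f_per; exists (\sum_(j < i + p) `|f j|) => n.
elim/ltn_ind: n => n IH; have [lt_n|le_n] := ltnP n (i + p).
  by rewrite (bigD1 (Ordinal lt_n))//= lerDl sumr_ge0.
have le_pn : (p <= n)%N by lia.
rewrite -(subnK le_pn) f_per; last by lia.
by apply: IH; lia.
Qed.

(** Subtracting the linear function of slope [D / p] leaves an eventually periodic, hence bounded,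
    sequence. *)
Lemma cvg_avg_periodic_increments f (D : R) i p : (0 < p)%N ->
  (forall n, (i <= n)%N -> f (n + p)%N = f n + D) ->
  n%:R^-1 * f n @[n --> \oo] --> D / p%:R.
Proof.
move=> p_gt0 f_per; pose g n := n%:R * (D / p%:R).
have p_neq0 : p%:R != 0 :> R by rewrite pnatr_eq0 -lt0n.
have [|K fgK] := @eventually_periodic_bounded (fun n => f n - g n) i p p_gt0.
  by move=> n le_in; rewrite f_per// /g natrD; field.
apply: cvg_avg_bounded_diff fgK _.
(* The average of [g] is constant only for [n > 0]; at [n = 0] it is [0]. *)
apply: cvg_near_cst; near=> n.
have n_neq0 : n%:R != 0 :> R.
  by rewrite pnatr_eq0 -lt0n; near: n; exact: nbhs_infty_gt.
by rewrite /g mulKf.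
Unshelve. all: by end_near.
Qed.

End Averages.

Lemma activity_avgE (R : realType) (G : digraph) (N : finite_abelian_network G)
    (u : config N -> seq (letter N)) (c : config N) (a : letter N) :
  activity_avg R u c a = (fun n => n%:R^-1 * (count_mem a (run u c n))%:R).
Proof.
apply/funext => n; rewrite /activity_avg -natr_sum; congr (_ * _%:R).
elim: n => [|n IH]; first by rewrite big_geq.
by rewrite big_nat_recr//= IH ffunE count_cat.
Qed.

Theorem proposition6p6 (R : realType) (G : digraph)
    (N : finite_abelian_network G)
    (N_irr : locally_irreducible N)
    (N_conn : strongly_connected N)
    (N_crit : critical N)
    (u : config N -> seq (letter N))
    (u_rule : is_update_rule u)
    (H1 : forall c : config N,
       (forall a, 0 <= c.1 a) -> c.1 <> 0 -> u c <> [::])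
    (H2 : forall (a : letter N) (c c' : config N), executes [:: a] c c' ->
       forall b, (parikh (u c) b <= parikh [:: a] b + parikh (u c') b)%N)
    (c c' : config N)
    (c_ge0 : forall a, 0 <= c.1 a)
    (c'_ge0 : forall a, 0 <= c'.1 a)
    (cc' : legally_related c c') :
  [/\ has_activity R u c, has_activity R u c'
    & activity R u c = activity R u c'].
Proof.
have [c3 [[w [lw wc3]] [w' [lw' w'c3]]]] := cc'.
(* Along a legal execution the letter counts of the two runs stay within a bounded distance, so
   their averages have the same limits. *)
have transfer (d : config N) v a (l : R) :
    (forall b, 0 <= d.1 b) -> legal v d ->
    (activity_avg R u d a @ \oo --> l) <->
    (activity_avg R u (fire_word v d) a @ \oo --> l).
  move=> d_ge0 lv; rewrite !activity_avgE.
  have [K run_geK] := run_ge u_rule H2 H1 N_conn N_crit d_ge0 lv.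
  have le_K n : `|(count_mem a (run u d n))%:R -
      (count_mem a (run u (fire_word v d) n))%:R| <= (K + size v)%:R :> R.
    have := run_le u_rule H2 n a lv; have := run_geK n a.
    rewrite -!(ler_nat R) !natrD ler_norml => le1 le2.
    have K_ge0 : 0 <= K%:R :> R by [].
    have v_ge0 : 0 <= (size v)%:R :> R by [].
    by apply/andP; split; lra.
  by split; apply: cvg_avg_bounded_diff => n; [rewrite distrC|]; exact: le_K.
have [B c_le] := legal_bounded N_crit N_conn c_ge0.
have [i [p p_gt0 per]] := update_eventually_periodic u_rule c_ge0 c_le.
(* Once on the cycle, each period fires the same letters up to order; the limit is their number
   divided by the period length. *)
have [l l_lim] : exists l, forall a, activity_avg R u c a @ \oo --> (l a : R).
  pose d := iter i (update u) c.
  exists (fun a => (count_mem a (run u d p))%:R / p%:R) => a.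
  rewrite activity_avgE; apply: (cvg_avg_periodic_increments (i := i) p_gt0).
  move=> n le_in; rewrite runD count_cat natrD -(subnK le_in) iterD.
  by rewrite (permP (run_cycle _ _) _)// -iterD addnC.
(* The limit is carried from [c] forward to [c3], then back from [c3] to [c']. *)
have lim' a : activity_avg R u c' a @ \oo --> l a.
  by apply/(transfer c' w')=> //; rewrite w'c3 -wc3; apply/(transfer c w).
split=> [a|a|]; [exact: cvgP (l_lim a) | exact: cvgP (lim' a) |].
apply/ffunP => a; rewrite !ffunE.
by rewrite (cvg_lim _ (l_lim a))// (cvg_lim _ (lim' a)).
Qed.
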